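(* Let $\lambda$ be a nonzero real number and let $r\ge 0$ be an integer. For all integers $n,k$ with $n\ge k\ge 1$, $${n+1+r \brace k+r}_{r,\lambda}={n+r \brace k-1+r}_{r,\lambda}+(\lambda k+r){n+r \brace k+r}_{r,\lambda}.$$
   Context: For a nonzero real $\lambda$, the generalized falling factorials are $(x)_{0,\lambda}=1$ and $(x)_{n,\lambda}=x(x-\lambda)\cdots(x-(n-1)\lambda)$ for $n\ge 1$. For an integer $r\ge 0$, the $\lambda$-analogues of $r$-Stirling numbers of the second kind ${n+r \brace k+r}_{r,\lambda}$ ($0\le k\le n$) are the real numbers uniquely determined by the polynomial identities in $x$ $$(x+r)^{n}=\sum_{k=0}^{n}{n+r \brace k+r}_{r,\lambda}(x)_{k,\lambda},\quad n\ge 0.$$ (So ${n+1+r \brace k+r}_{r,\lambda}$ is the coefficient of $(x)_{k,\lambda}$ in $(x+r)^{n+1}$, and ${n+r \brace k-1+r}_{r,\lambda}$ is the coefficient of $(x)_{k-1,\lambda}$ in $(x+r)^n$.) *)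

(* Defs.v *)
From HB Require Import structures.
From mathcomp Require Import all_boot all_order all_algebra.
From mathcomp Require Import boolp reals.

Set Implicit Arguments.
Unset Strict Implicit.
Unset Printing Implicit Defensive.

Import Order.TTheory GRing.Theory Num.Theory.
Local Open Scope ring_scope.

Definition gfall (R : realType) (lambda : R) (n : nat) : {poly R} :=
  \prod_(i < n) ('X - (i%:R * lambda)%:P).

Definition gfall_expansion (R : realType) (lambda : R) (r n : nat)
    (a : nat -> R) : Prop :=
  ('X + r%:R%:P) ^+ n = \sum_(k < n.+1) a k *: gfall lambda k.

Lemma gfall_monic (R : realType) (lambda : R) (n : nat) :
  gfall lambda n \is monic.
Proof. by apply: monic_prod => i _; apply: monicXsubC. Qed.

Lemma size_gfall (R : realType) (lambda : R) (n : nat) :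
  size (gfall lambda n) = n.+1.
Proof. by rewrite size_prod_XsubC [index_enum _]unlock -enumT size_enum_ord. Qed.

Lemma gfall_span (R : realType) (lambda : R) (n : nat) (p : {poly R}) :
  (size p <= n)%N ->
  exists a : nat -> R, p = \sum_(k < n) a k *: gfall lambda k.
Proof.
elim: n p => [|n IHn] p szp.
  exists (fun=> 0); rewrite big_ord0; apply/eqP.
  by rewrite -size_poly_eq0 -leqn0.
have [|a Ea] := IHn (p - p`_n *: gfall lambda n).
  apply/leq_sizeP => j; rewrite coefB coefZ leq_eqVlt => /predU1P[<-|ltnj].
    have /monicP := gfall_monic lambda n.
    by rewrite lead_coefE size_gfall /= => ->; rewrite mulr1 subrr.
  rewrite (leq_sizeP _ _ szp j ltnj) [(gfall lambda n)`_j]nth_default.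
    by rewrite mulr0 subr0.
  by rewrite size_gfall.
exists (fun k => if k == n then p`_n else a k).
rewrite big_ord_recr /= eqxx; apply/eqP; rewrite -subr_eq Ea; apply/eqP.
by apply: eq_bigr => i _; rewrite ltn_eqF.
Qed.

Lemma gfall_free (R : realType) (lambda : R) (n : nat) (a b : nat -> R) :
  \sum_(k < n) a k *: gfall lambda k = \sum_(k < n) b k *: gfall lambda k ->
  forall k, (k < n)%N -> a k = b k.
Proof.
elim: n => [//|n IHn] eq_ab.
have coefn (c : nat -> R) :
    (\sum_(k < n.+1) c k *: gfall lambda k)`_n = c n.
  rewrite big_ord_recr /= coefD coef_sum big1 ?add0r => [|i _]; last first.
    by rewrite coefZ nth_default ?mulr0 // size_gfall.
  have /monicP := gfall_monic lambda n.
  by rewrite coefZ lead_coefE size_gfall /= => ->; rewrite mulr1.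
have eqn : a n = b n by rewrite -(coefn a) eq_ab coefn.
move: eq_ab; rewrite !big_ord_recr /= eqn => /addIr/IHn eq_lt k.
by rewrite ltnS leq_eqVlt => /predU1P[->|/eq_lt].
Qed.

Lemma gfall_expansion_ex (R : realType) (lambda : R) (r n : nat) :
  exists a : nat -> R, gfall_expansion lambda r n a.
Proof.
apply: gfall_span; rewrite -[r%:R%:P]opprK -polyCN size_exp_XsubC.
exact: leqnn.
Qed.

(* [rStirling2 lambda r n k] is the number written {n+r \brace k+r}_{r,lambda}:
   both indices are unshifted.  Only the values with k <= n are meaningful;
   the others are unspecified. *)
Definition rStirling2 (R : realType) (lambda : R) (r n k : nat) : R :=
  projT1 (cid (gfall_expansion_ex lambda r n)) k.

Lemma rStirling2P (R : realType) (lambda : R) (r n : nat) :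
  gfall_expansion lambda r n (rStirling2 lambda r n).
Proof. exact: (projT2 (cid (gfall_expansion_ex lambda r n))). Qed.

Lemma rStirling2_unique (R : realType) (lambda : R) (r n : nat)
    (a : nat -> R) :
  gfall_expansion lambda r n a ->
  forall k, (k <= n)%N -> a k = rStirling2 lambda r n k.
Proof.
rewrite /gfall_expansion (rStirling2P lambda r n) => eq_a k le_kn.
by apply/esym/(gfall_free eq_a).
Qed.

(* Main.v *)
(* Multiply the expansion of (x+r)^n by x + r = (x - k lambda) + (lambda k + r)
   and compare coefficients in the basis of falling factorials. *)
Require Import Defs.
From mathcomp Require Import all_boot all_order all_algebra.
From mathcomp Require Import reals.

Import GRing.Theory Num.Theory.
Local Open Scope ring_scope.

(** By [gfall_mulXDC], multiplication by X + r turns an expansion of (X + r)^n into one of (X +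
    r)^(n+1), made explicit in [gfall_expansionS]. Linear independence of the falling factorials
    ([rStirling2_unique]) identifies its coefficients. *)

Lemma gfall_mulXDC (R : realType) (lambda c : R) (k : nat) :
  gfall lambda k * ('X + c%:P) =
    gfall lambda k.+1 + (lambda * k%:R + c) *: gfall lambda k.
Proof.
rewrite /gfall big_ord_recr /= -mul_polyC [_%:P * _]mulrC -mulrDr polyCD.
by rewrite [k%:R * _]mulrC addrA subrK.
Qed.

(* The guard [k <= n] discards [a n.+1], which [gfall_expansion] leaves
   arbitrary. *)
Lemma gfall_expansionS (R : realType) (lambda : R) (r n : nat)
    (a : nat -> R) :
  gfall_expansion lambda r n a ->
  gfall_expansion lambda r n.+1 (fun k =>
    (if k is j.+1 then a j else 0) +
    (if (k <= n)%N then (lambda * k%:R + r%:R) * a k else 0)).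
Proof.
rewrite /gfall_expansion exprSr => ->; rewrite mulr_suml.
under eq_bigr do rewrite -scalerAl gfall_mulXDC scalerDr scalerA mulrC.
under [RHS]eq_bigr do rewrite scalerDl.
rewrite !big_split /=; congr (_ + _).
  (* The degree-raising terms match after an index shift; the extra coefficient at 0 is 0. *)
  by rewrite [RHS]big_ord_recl /= scale0r add0r.
rewrite [RHS]big_ord_recr /= ltnn scale0r addr0.
by apply: eq_bigr => i _; rewrite -ltnS ltn_ord [_ * a _]mulrC.
Qed.

Theorem theorem4 (R : realType) (lambda : R) (r n k : nat)
    (hlambda : lambda != 0) (hk : (1 <= k)%N) (hkn : (k <= n)%N) :
  rStirling2 lambda r n.+1 k =
    rStirling2 lambda r n k.-1
      + (lambda * k%:R + r%:R) * rStirling2 lambda r n k.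
Proof.
have E := gfall_expansionS _ _ _ _ _ (rStirling2P lambda r n).
rewrite -(rStirling2_unique E (leqW hkn)) hkn.
(* For a successor [k], the [if k is j.+1] branch computes to the value at [k.-1]. *)
by case: k hk {hkn}.
Qed.
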